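(* Let $M=\varprojlim M_i$ be a projective limit of Banach manifolds. The limit of a projective system of dissections of $\{M_i\}_{i\in\mathbb N}$ is a dissection of $M=\varprojlim M_i$.
   Context: Setting. $\{(M_i,\varphi_{ji})\}_{i,j\in\mathbb N}$ is a projective system of smooth Banach manifolds (connecting maps $\varphi_{ji}:M_j\to M_i$, $j\ge i$), where $M_i$ is modelled on the Banach space $\mathbb E_i$ and $\{\mathbb E_i,\rho_{ji}\}$ is a projective system of Banach spaces with continuous linear maps $\rho_{ji}:\mathbb E_j\to\mathbb E_i$ and limit the Fréchet space $\mathbb F=\varprojlim\mathbb E_i$. For each $m=(m_i)\in M=\varprojlim M_i$ there is a projective system of charts $(U_i,\varphi_i)$ of $M_i$ with $m_i\in U_i$ (so $\varphi_i\circ\varphi_{ji}=\rho_{ji}\circ\varphi_j$) and $U=\varprojlim U_i$ open in $M$. The pairs $(U=\varprojlim U_i,\varphi=\varprojlim\varphi_i)$ are the charts of the Fréchet manifold $M$. Notation. $L^2_s(\mathbb E,\mathbb E)$ and $L^2_s(\mathbb E,\mathbb R)$ are the spaces of continuous symmetric bilinear maps on $\mathbb E$ with values in $\mathbb E$ and $\mathbb R$, and $\mathbb E^*$ is the continuous dual. $\mathcal H^2(\mathbb F,\mathbb F)$ is the Fréchet space of sequences $(B_i)$ of continuous bilinear maps $B_i:\mathbb E_i\times\mathbb E_i\to\mathbb E_i$ for which $\varprojlim B_i$ exists, i.e. $B_i\circ(\rho_{ji}\times\rho_{ji})=\rho_{ji}\circ B_j$ for $j\ge i$. On Fréchet manifolds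 it replaces the space of bilinear maps of the model space. 2-jets and dissections on a Banach manifold $N$ modelled on $\mathbb E$. For $m\in N$, $J^2_mN$ is the space of 2-jets at $m$ of smooth real functions defined near $m$ and vanishing at $m$ (functions are identified if their first and second derivatives at $m$ agree in charts). In a chart $(U,\varphi)$, $s\in J^2_mN$ is represented by $s_\varphi=\alpha_\varphi\oplus B_\varphi\in\mathbb E^*\oplus L^2_s(\mathbb E,\mathbb R)$, with $\alpha_\psi=\alpha_\varphi\circ DG(v)$ and $B_\psi=B_\varphi\circ(DG(v)\times DG(v))+\alpha_\varphi\circ DG(v)\circ D^2F(u)\circ(DG(v)\times DG(v))$, where $u=\varphi(m)$, $v=\psi(m)$, $F=\psi\circ\varphi^{-1}$, $G=\varphi\circ\psi^{-1}$ (for $s=[f]$: $\alpha_\varphi=D(f\circ\varphi^{-1})(u)$, $B_\varphi=-D^2(f\circ\varphi^{-1})(u)$). A dissection on $N$ is a map assigning to every $m\in N$ a closed subgroup $D_m$ of $J^2_mN$ such that for every chart $(U,\varphi)$ there is a smooth map $\Gamma_\varphi:\varphi(U)\to L^2_s(\mathbb E,\mathbb E)$ with $B_\varphi=\alpha_\varphi\circ\Gamma_\varphi(u)$ for $s\in D_m$, $s_\varphi=\alpha_\varphi\oplus B_\varphi$; in other words $[D_m]_\varphi=\{\alpha\oplus(\alpha\circ\Gamma_\varphi(u)):\alpha\in\mathbb E^*\}$. 2-jets and dissections on $M=\varprojlim M_i$. $J^2_mM$ is formed in the same way from the functions $f=\varprojlim f_i$, where $f_i$ is a smooth real function near $m_i$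 with $f_i(m_i)=0$ and $f_j=f_i\circ\varphi_{ji}$ for $j\ge i$; via $[f,m]\mapsto([f_i,m_i])_i$ it is identified (set-theoretically) with $\varprojlim J^2_{m_i}M_i$. A dissection on $M$ is a map assigning to every $m\in M$ a closed subgroup $D_m$ of $J^2_mM$ such that for every chart $(U=\varprojlim U_i,\varphi=\varprojlim\varphi_i)$ there is a smooth map $\Gamma_\varphi=\varprojlim\Gamma_{\varphi_i}:\varphi(U)\to\mathcal H^2(\mathbb F,\mathbb F)$ with symmetric values and $[D_m]_\varphi=\{\alpha\oplus(\alpha\circ\Gamma_\varphi(u))\}$, $u=\varphi(m)$, where $\alpha=\varprojlim\alpha_i$ runs over the families $\alpha_i\in\mathbb E_i^*$ with $\alpha_j=\alpha_i\circ\rho_{ji}$. A projective system of dissections consists of a dissection $m_i\mapsto D_{m_i}$ on each $M_i$ such that, for every $m=(m_i)\in M$, the subgroups $D_{m_i}\subseteq J^2_{m_i}M_i$ are compatible with the maps between the 2-jet spaces induced by the $\varphi_{ji}$ (the pullback $[f]\mapsto[f\circ\varphi_{ji}]$ takes $D_{m_i}$ into $D_{m_j}$ for $j\ge i$). Its limit is the assignment $m\mapsto\varprojlim D_{m_i}\subseteq\varprojlim J^2_{m_i}M_i=J^2_mM$, consisting of the compatible families of elements of the $D_{m_i}$. *)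

(* Defs.v *)
From HB Require Import structures.
From mathcomp Require Import all_boot all_order all_algebra.
From mathcomp Require Import all_classical all_reals all_analysis.

Set Implicit Arguments.
Unset Strict Implicit.
Unset Printing Implicit Defensive.
Import Order.TTheory GRing.Theory Num.Theory.
Import numFieldNormedType.Exports.
Local Open Scope classical_set_scope.
Local Open Scope ring_scope.

(** [clin E F] is the space of continuous linear maps with the operator norm;
    the continuous bilinear maps [E * E -> F] are represented (isometrically)
    by the elements of [clin E (clin E F)]. *)
Section ContinuousLinear.
Context (R : realType) (E F : normedModType R).

Definition clin_pred : {pred E -> F} :=
  fun f => `[< linear f /\ continuous f >].

Lemma clin_submod : submod_closed clin_pred.
Proof.
split.
  apply/asboolP; split; last by move=> x; exact: cvg_cst.
  by move=> a u v; rewrite /= scaler0 addr0.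
move=> a f g /asboolP[lf cf] /asboolP[lg cg]; apply/asboolP; split.
  move=> b u v; rewrite !fctE lf lg !scalerDr !scalerA [a * b]mulrC -!addrA.
  by congr (_ + _); rewrite addrCA.
move=> x; apply: cvgD; last exact: cg.
by apply: cvgZl_tmp; exact: cf.
Qed.

HB.instance Definition _ :=
  GRing.isSubmodClosed.Build R (E -> F) clin_pred clin_submod.

Record clin := Clin { clin_fun :> E -> F; clinP : clin_fun \in clin_pred }.

HB.instance Definition _ := [isSub for clin_fun].
HB.instance Definition _ := [Choice of clin by <:].
HB.instance Definition _ := [SubChoice_isSubLmodule of clin by <:].

Lemma clin_linear (f : clin) : linear f.
Proof. by have /asboolP[] := clinP f. Qed.

HB.instance Definition _ (f : clin) :=
  GRing.isLinear.Build R E F _ (f : E -> F) (clin_linear f).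

Lemma clin_continuous (f : clin) : continuous f.
Proof. by have /asboolP[] := clinP f. Qed.

Lemma clin_lcE (a : R) (f g : clin) x : (a *: f + g) x = a *: f x + g x.
Proof. by []. Qed.

Definition opnorm (f : clin) : R := sup [set `|f x| | x in [set x : E | `|x| <= 1]].

Lemma opnorm_has_sup (f : clin) :
  has_sup [set `|f x| | x in [set x : E | `|x| <= 1]].
Proof.
split; first by exists `|f 0|; exists 0 => //=; rewrite normr0.
have /bounded_funP/(_ 1)[M hM] : bounded_near f (nbhs (0 : E)).
  by apply: continuous_linear_bounded; exact: clin_continuous.
by exists M => _ [x /= x1 <-]; exact: hM.
Qed.

Lemma ler_opnorm1 (f : clin) x : `|x| <= 1 -> `|f x| <= opnorm f.
Proof. by move=> x1; apply: sup_upper_bound; [exact: opnorm_has_sup|exists x]. Qed.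

Lemma opnorm_le (f : clin) (M : R) :
  (forall x, `|x| <= 1 -> `|f x| <= M) -> opnorm f <= M.
Proof.
move=> h; apply: ge_sup; first by case: (opnorm_has_sup f).
by move=> _ [x /= x1 <-]; exact: h.
Qed.

Lemma opnorm_ge0 f : 0 <= opnorm f.
Proof. by apply: le_trans (ler_opnorm1 f (x := 0) _); rewrite ?normr0. Qed.

Lemma opnormD f g : opnorm (f + g) <= opnorm f + opnorm g.
Proof.
apply: opnorm_le => x x1; apply: le_trans (ler_normD _ _) _.
by apply: lerD; exact: ler_opnorm1.
Qed.

Lemma opnormZ a f : opnorm (a *: f) = `|a| * opnorm f.
Proof.
have le b g : opnorm (b *: g) <= `|b| * opnorm g.
  by apply: opnorm_le => x x1; rewrite /= normrZ ler_wpM2l// ler_opnorm1.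
apply/eqP; rewrite eq_le le/=; have [->|a0] := eqVneq a 0.
  by rewrite normr0 mul0r opnorm_ge0.
rewrite -ler_pdivlMl ?normr_gt0// -normfV.
by rewrite -{1}[f](scalerK a0); exact: le.
Qed.

Lemma opnorm_eq0 f : opnorm f = 0 -> f = 0.
Proof.
move=> f0; apply/val_inj/funext => x /=.
have [->|x0] := eqVneq x 0; first by rewrite linear0.
have nx0 : `|x| != 0 by rewrite normr_eq0.
have : `|f (`|x|^-1 *: x)| <= 0.
  by rewrite -f0 ler_opnorm1// normrZ normfV normr_id mulVf.
rewrite normr_le0 linearZ/= scaler_eq0 invr_eq0 (negbTE nx0)/=.
by move=> /eqP.
Qed.

HB.instance Definition _ :=
  Lmodule_isNormed.Build R clin opnormD opnormZ opnorm_eq0.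

End ContinuousLinear.
Arguments clin {R} E F.


Section Smooth.
Context (R : realType).

Section Derivative.
Context (E F : normedModType R).
Implicit Types (f : E -> F) (x : E).

Lemma diff_clin f x : differentiable f x -> ('d f x : E -> F) \in @clin_pred R E F.
Proof.
move=> df; apply/asboolP; split; last exact: diff_continuous.
by move=> a u v; rewrite linearP.
Qed.

Definition Der f x : clin E F :=
  if pselect (differentiable f x) is left df then Clin (diff_clin df) else 0.

Lemma DerE f x : differentiable f x -> Der f x = 'd f x :> (E -> F).
Proof. by move=> df; rewrite /Der; case: pselect. Qed.

Lemma near_eq_differentiable f g x : (\near x, f x = g x) ->
  differentiable f x -> differentiable g x /\ 'd g x = 'd f x :> (E -> F).
Proof.
move=> fg df.
have h : g \o shift x = cst (g x) + 'd f x +o_ 0 id.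
  have fgx : f x = g x by exact: nbhs_singleton fg.
  rewrite -fgx.
  apply/eqaddoP => _/posnumP[e].
  have := diff_locally df => /eqaddoP /(_ e%:num (gt0 e)).
  have fg' : \forall y \near 0, f (y + x) = g (y + x).
    by move: fg; rewrite (near_shift 0) subr0.
  apply: filter_app; apply: filter_app fg'; near=> y => fgy.
  by rewrite !fctE /= fgy.
have dgf : 'd g x = 'd f x :> (E -> F).
  by apply: diff_unique => //; exact: diff_continuous.
by split=> //; apply/diff_locallyP; rewrite dgf; split=> //; exact: diff_continuous.
Unshelve. all: by end_near. Qed.

End Derivative.

(** [C^n] on an (open) set [U], in the sense of Fréchet. *)
Fixpoint Ck (n : nat) (E F : normedModType R) (U : set E) (f : E -> F) : Prop :=
  if n is n'.+1 then
    (forall x, U x -> differentiable f x) /\ Ck n' U (Der f)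
  else forall x, U x -> {for x, continuous f}.

Definition smooth_on (E F : normedModType R) (U : set E) (f : E -> F) : Prop :=
  forall n, Ck n U f.

Lemma CkS n (E F : normedModType R) (U V : set E) (f : E -> F) :
  V `<=` U -> Ck n U f -> Ck n V f.
Proof.
elim: n F f => [|n ih] F f VU /=; first by move=> h x /VU/h.
by move=> [h1 h2]; split; [move=> x /VU/h1|exact: ih].
Qed.

Lemma eq_Ck n (E F : normedModType R) (U : set E) (f g : E -> F) : open U ->
  {in U, f =1 g} -> Ck n U f -> Ck n U g.
Proof.
elim: n F f g => [|n ih] F f g oU fg.
  move=> h x Ux; have := h x Ux; rewrite /prop_for/continuous_at -fg ?inE//.
  move=> fx; apply: cvg_trans fx; apply: near_eq_cvg.
  by near=> y; apply/fg; rewrite inE; near: y; exact: open_nbhs_nbhs.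
move=> [h1 h2].
have nfg x : U x -> \near x, f x = g x.
  move=> Ux; near=> y; apply/fg; rewrite inE; near: y.
  exact: open_nbhs_nbhs.
split; first by move=> x Ux; have [] := near_eq_differentiable (nfg x Ux) (h1 _ Ux).
apply: ih h2 => // x; rewrite inE => Ux.
have [dg gf] := near_eq_differentiable (nfg x Ux) (h1 _ Ux).
by apply/val_inj; rewrite /= !DerE ?gf//; exact: h1.
Unshelve. all: by end_near. Qed.

Lemma DerB (E F : normedModType R) (f g : E -> F) x :
  differentiable f x -> differentiable g x -> Der (f - g) x = Der f x - Der g x.
Proof.
move=> df dg; apply/val_inj.
rewrite /= [LHS]DerE; last exact: differentiableB.
by rewrite diffB// !DerE.
Qed.

Lemma CkB n (E F : normedModType R) (U : set E) (f g : E -> F) : open U ->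
  Ck n U f -> Ck n U g -> Ck n U (f - g).
Proof.
move=> oU; elim: n F f g => [|n ih] F f g /=.
  by move=> h1 h2 x Ux; apply: continuousB; [exact: h1|exact: h2].
move=> [f1 f2] [g1 g2]; split.
  by move=> x Ux; apply: differentiableB; [exact: f1|exact: g1].
apply: (@eq_Ck _ _ _ _ (Der f - Der g)) => //; last exact: ih.
by move=> x; rewrite inE => Ux; rewrite DerB//; [exact: f1|exact: g1].
Qed.

Lemma Der0 (E F : normedModType R) : Der (0 : E -> F) = 0.
Proof.
apply/funext => x; apply/val_inj; rewrite /= DerE; last exact: differentiable_cst.
by rewrite (diff_cst (0 : F) x).
Qed.

Lemma Ck0 n (E F : normedModType R) (U : set E) : Ck n U (0 : E -> F).
Proof.
elim: n F => [|n ih] F; first by move=> x _; exact: cvg_cst.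
by split; [move=> x _; exact: differentiable_cst|rewrite Der0; exact: ih].
Qed.

Lemma near_eq_Der (E F : normedModType R) (f g : E -> F) x :
  (\near x, f x = g x) -> differentiable f x -> Der f x = Der g x.
Proof.
move=> fg df; have [dg e] := near_eq_differentiable fg df.
by apply/val_inj; rewrite /= !DerE.
Qed.

End Smooth.

Section Manifold.
Context (R : realType).

(** [chart_inv] and [chart_fun] are total functions; their values outside of
    [chart_img] and [chart_dom] are irrelevant. *)
Record chart (T : topologicalType) (E : normedModType R) := Chart {
  chart_dom : set T ;
  chart_fun :> T -> E ;
  chart_inv : E -> T ;
  chart_domO : open chart_dom ;
  chart_imgO : open (chart_fun @` chart_dom) ;
  chart_funK : {in chart_dom, cancel chart_fun chart_inv} ;
  chart_funC : {in chart_dom, continuous chart_fun} ;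
  chart_invC : {in chart_fun @` chart_dom, continuous chart_inv} }.

Definition chart_img (T : topologicalType) (E : normedModType R)
  (c : chart T E) : set E := c @` chart_dom c.

Definition compatible (T : topologicalType) (E : normedModType R)
    (c d : chart T E) : Prop :=
  smooth_on (c @` (chart_dom c `&` chart_dom d)) (d \o chart_inv c).

Record banachManifold (E : completeNormedModType R) := BanachManifold {
  bm_space :> topologicalType ;
  atlas : set (chart bm_space E) ;
  atlas_cover : forall m, exists2 c, atlas c & chart_dom c m ;
  atlas_compatible : forall c d, atlas c -> atlas d -> compatible c d ;
  atlas_maximal : forall c,
    (forall d, atlas d -> compatible c d /\ compatible d c) -> atlas c }.

Definition chart_at (E : completeNormedModType R) (N : banachManifold E)
  (m : N) : set (chart N E) := [set c | atlas c /\ chart_dom c m].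

Definition smooth_map (E E' : completeNormedModType R) (N : banachManifold E)
    (N' : banachManifold E') (f : N -> N') : Prop :=
  continuous f /\
  forall c d, atlas c -> atlas d ->
    smooth_on (c @` (chart_dom c `&` f @^-1` chart_dom d))
              (d \o f \o chart_inv c).

End Manifold.

Section Jets.
Context (R : realType) (E : completeNormedModType R) (N : banachManifold E).
Variable m : N.

Definition local_fun : {pred N -> R^o} := fun f =>
  `[< f m = 0 /\ forall c, chart_at m c ->
      exists2 V, open_nbhs (c m) V & smooth_on V (f \o chart_inv c) >].

Lemma local_fun_zmod : zmod_closed local_fun.
Proof.
split.
  apply/asboolP; split=> // c _; exists setT; last by move=> n; exact: Ck0.
  by split=> //; exact: openT.
move=> f g /asboolP[f0 fC] /asboolP[g0 gC]; apply/asboolP; split.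
  by rewrite !fctE f0 g0 subr0.
move=> c cm; have [V Vc Vf] := fC c cm; have [W Wc Wg] := gC c cm.
exists (V `&` W); first exact: open_nbhsI.
move=> n; apply: CkB; first by apply: openI; [case: Vc|case: Wc].
- by apply: CkS (Vf n); exact: subIsetl.
- by apply: CkS (Wg n); exact: subIsetr.
Qed.

HB.instance Definition _ :=
  GRing.isZmodClosed.Build (N -> R^o) local_fun local_fun_zmod.

Record germ := Germ { germ_fun :> N -> R^o ; germP : germ_fun \in local_fun }.
HB.instance Definition _ := [isSub for germ_fun].
HB.instance Definition _ := [Choice of germ by <:].
HB.instance Definition _ := [SubChoice_isSubZmodule of germ by <:].

(** First component: the differential; second component: minus the second
    differential, of the expression of [f] in the chart [c]. *)
Definition jet_rep_fun (c : chart N E) (f : N -> R^o) :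
    clin E R^o * clin E (clin E R^o) :=
  (Der (f \o chart_inv c) (c m), - Der (Der (f \o chart_inv c)) (c m)).

(** Two germs define the same 2-jet when their difference lies in [flat2]. *)
Definition flat2 : {pred germ} := fun f =>
  `[< forall c, chart_at m c -> jet_rep_fun c f = 0 >].

Lemma jet_rep_funB c (f g : germ) : chart_at m c ->
  jet_rep_fun c (f - g) = jet_rep_fun c f - jet_rep_fun c g.
Proof.
move=> cm; have /asboolP[_ /(_ c cm)[V Vc Vf]] := germP f.
have /asboolP[_ /(_ c cm)[W Wc Wg]] := germP g.
have VWc := open_nbhsI Vc Wc.
have df x : (V `&` W) x -> differentiable (f \o chart_inv c) x.
  by move=> [Vx _]; have [+ _] := Vf 1; exact.
have dg x : (V `&` W) x -> differentiable (g \o chart_inv c) x.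
  by move=> [_ Wx]; have [+ _] := Wg 1; exact.
have dDf : differentiable (Der (f \o chart_inv c)) (c m).
  by have [_ [+ _]] := Vf 2; apply; exact: (Vc.2).
have dDg : differentiable (Der (g \o chart_inv c)) (c m).
  by have [_ [+ _]] := Wg 2; apply; exact: (Wc.2).
have VWcm := VWc.2.
have e1 x : (V `&` W) x -> Der ((f - g) \o chart_inv c) x =
    Der (f \o chart_inv c) x - Der (g \o chart_inv c) x.
  by move=> VWx; rewrite -DerB; [|exact: df|exact: dg].
have e2 : Der (Der ((f - g) \o chart_inv c)) (c m) =
    Der (Der (f \o chart_inv c)) (c m) - Der (Der (g \o chart_inv c)) (c m).
  rewrite -DerB//; apply/esym/near_eq_Der; last exact: differentiableB.
  by near=> x; rewrite e1//; near: x; exact: open_nbhs_nbhs.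
by rewrite /jet_rep_fun e1// e2 opprD.
Unshelve. all: by end_near. Qed.

Lemma flat2_zmod : zmod_closed flat2.
Proof.
split.
  by apply/asboolP => c _; rewrite /jet_rep_fun [_ \o _]/(0 : E -> R^o) !Der0 oppr0.
move=> f g /asboolP f0 /asboolP g0; apply/asboolP => c cm.
by rewrite jet_rep_funB// f0// g0// subr0.
Qed.

HB.instance Definition _ := GRing.isZmodClosed.Build germ flat2 flat2_zmod.

Definition jet2 : Type := Quotient.quot flat2.
HB.instance Definition _ := GRing.Zmodule.on jet2.

Definition jet_rep (c : chart N E) (s : jet2) := jet_rep_fun c (repr s).

Definition jet_reps (s : jet2) : prod_topology
    (fun _ : {c | chart_at m c} => (clin E R^o * clin E (clin E R^o))%type) :=
  fun c => jet_rep (sval c) s.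

HB.instance Definition _ := Topological.copy jet2 (initial_topology jet_reps).

Definition jet (f : N -> R^o) : jet2 :=
  if insub f is Some g then \pi_(Quotient.quot flat2)%qT g else 0.

End Jets.

Section Dissection.
Context (R : realType) (E : completeNormedModType R) (N : banachManifold E).

(** The set of all [alpha (+) (alpha o G)], [alpha] in the dual of [E]. *)
Definition dissection_rep (G : clin E (clin E E)) :
    set (clin E R^o * clin E (clin E R^o)) :=
  [set s : clin E R^o * clin E (clin E R^o) |
    forall x y : E, s.2 x y = s.1 (G x y)].

(** The symmetric bilinear maps form a closed subspace of the bilinear ones, so
    that smoothness into either space is the same. *)
Definition is_dissection (D : forall m : N, set (jet2 m)) : Prop :=
  (forall m, zmod_closed [in D m] /\ closed (D m)) /\
  forall c, atlas c -> exists Gamma : E -> clin E (clin E E),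
    [/\ smooth_on (chart_img c) Gamma,
        forall u, chart_img c u -> forall x y, Gamma u x y = Gamma u y x &
        forall m, chart_dom c m ->
          [set jet_rep c s | s in D m] = dissection_rep (Gamma (c m)) ].

End Dissection.

Section ProdZmodule.
Context (I : Type) (V : I -> zmodType).
Local Notation P := (prod_topology V).

Let add (x y : P) : P := fun i => x i + y i.
Let opp (x : P) : P := fun i => - x i.
Let zero : P := fun=> 0.

Let addA : associative add.
Proof. by move=> x y z; apply/functional_extensionality_dep => i; exact: addrA. Qed.
Let addC : commutative add.
Proof. by move=> x y; apply/functional_extensionality_dep => i; exact: addrC. Qed.
Let add0 : left_id zero add.
Proof. by move=> x; apply/functional_extensionality_dep => i; exact: add0r. Qed.
Let addN : left_inverse zero opp add.
Proof. by move=> x; apply/functional_extensionality_dep => i; exact: addNr. Qed.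

HB.instance Definition _ := GRing.isZmodule.Build P addA addC add0 addN.

End ProdZmodule.

Section ProdLmodule.
Context (R : realType) (I : Type) (V : I -> lmodType R).
Local Notation P := (prod_topology V).

Let scale (a : R) (x : P) : P := fun i => a *: x i.

Let scaleA a b x : scale a (scale b x) = scale (a * b) x.
Proof. by apply/functional_extensionality_dep => i; exact: scalerA. Qed.
Let scale1 : left_id 1 scale.
Proof. by move=> x; apply/functional_extensionality_dep => i; exact: scale1r. Qed.
Let scaleDr : right_distributive scale +%R.
Proof. by move=> a x y; apply/functional_extensionality_dep => i; exact: scalerDr. Qed.
Let scaleDl x : {morph scale^~ x : a b / a + b}.
Proof. by move=> a b; apply/functional_extensionality_dep => i; exact: scalerDl. Qed.

HB.instance Definition _ :=
  GRing.Zmodule_isLmodule.Build R P scaleA scale1 scaleDr scaleDl.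

Lemma prod_lcE (a : R) (x y : P) i : (a *: x + y) i = a *: x i + y i.
Proof. by []. Qed.

End ProdLmodule.

Section BanachSystem.
Context (R : realType).

(** Only the maps [bs_map j i] with [i <= j] are relevant; likewise for
    [ms_map] below. *)
Record banachSystem := BanachSystem {
  bs_space :> nat -> completeNormedModType R ;
  bs_map : forall j i, clin (bs_space j) (bs_space i) ;
  bs_map_id : forall i x, bs_map i i x = x ;
  bs_map_comp : forall i j k x, (i <= j)%N -> (j <= k)%N ->
    bs_map j i (bs_map k j x) = bs_map k i x }.

Variable S : banachSystem.

Definition frechet_pred : {pred prod_topology (fun i => S i)} := fun x =>
  `[< forall i j, (i <= j)%N -> bs_map S j i (x j) = x i >].

Lemma frechet_submod : submod_closed frechet_pred.
Proof.
split; first by apply/asboolP => i j _; exact: linear0.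
move=> a x y /asboolP hx /asboolP hy; apply/asboolP => i j ij.
by rewrite !prod_lcE linearP/= hx// hy.
Qed.

HB.instance Definition _ :=
  GRing.isSubmodClosed.Build R (prod_topology (fun i => S i)) frechet_pred frechet_submod.

Record frechet := Frechet {
  frechet_val : prod_topology (fun i => S i) ;
  frechetP : frechet_val \in frechet_pred }.
HB.instance Definition _ := [isSub for frechet_val].
HB.instance Definition _ := [Choice of frechet by <:].
HB.instance Definition _ := [SubChoice_isSubLmodule of frechet by <:].
HB.instance Definition _ := Topological.copy frechet (initial_topology frechet_val).
Definition frechet_fun (x : frechet) : forall i, S i := frechet_val x.
Coercion frechet_fun : frechet >-> Funclass.

(** [frechet S] is F = lim E_i and [hom2 S] is H^2(F, F), both with the topology
    induced by the product. *)
Definition hom2_pred :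
    {pred prod_topology (fun i => clin (S i) (clin (S i) (S i)))} := fun B =>
  `[< forall i j, (i <= j)%N -> forall x y : S j,
      B i (bs_map S j i x) (bs_map S j i y) = bs_map S j i (B j x y) >].

Lemma hom2_submod : submod_closed hom2_pred.
Proof.
split; first by apply/asboolP => i j _ x y; rewrite [RHS]linear0.
move=> a B C /asboolP hB /asboolP hC; apply/asboolP => i j ij x y.
by rewrite !prod_lcE !clin_lcE linearP/= hB// hC.
Qed.

HB.instance Definition _ := GRing.isSubmodClosed.Build R
  (prod_topology (fun i => clin (S i) (clin (S i) (S i)))) hom2_pred hom2_submod.

Record hom2 := Hom2 {
  hom2_val : prod_topology (fun i => clin (S i) (clin (S i) (S i))) ;
  hom2P : hom2_val \in hom2_pred }.
HB.instance Definition _ := [isSub for hom2_val].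
HB.instance Definition _ := [Choice of hom2 by <:].
HB.instance Definition _ := [SubChoice_isSubLmodule of hom2 by <:].
HB.instance Definition _ := Topological.copy hom2 (initial_topology hom2_val).
Definition hom2_fun (x : hom2) : forall i, clin (S i) (clin (S i) (S i)) := hom2_val x.
Coercion hom2_fun : hom2 >-> Funclass.

End BanachSystem.

Section FrechetSmooth.
Context (R : realType).

HB.instance Definition _ (X Y : preTopologicalLmodType R) :=
  Topological.on (X * Y)%type.

(** [C^n] on an (open) set [U] in the sense of Michal-Bastiani: the iterated
    directional derivatives exist and are jointly continuous; [df (x, v)] is
    the derivative of [f] at [x] in the direction [v]. *)
Fixpoint frechet_Ck (n : nat) (X Y : preTopologicalLmodType R) (U : set X)
    (f : X -> Y) : Prop :=
  (forall x, U x -> {for x, continuous f}) /\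
  if n is n'.+1 then
    exists df : X * X -> Y,
      (forall x v, U x ->
        (fun t : R => t^-1 *: (f (x + t *: v) - f x)) @ 0^' --> df (x, v)) /\
      @frechet_Ck n' (X * X)%type Y (U `*` setT) df
  else True.

Definition frechet_smooth_on (X Y : preTopologicalLmodType R) (U : set X)
  (f : X -> Y) : Prop := forall n, frechet_Ck n U f.

End FrechetSmooth.

Section ManifoldSystem.
Context (R : realType) (S : banachSystem R).

Record preManifoldSystem := PreManifoldSystem {
  ms_space :> forall i, banachManifold (S i) ;
  ms_map : forall j i, ms_space j -> ms_space i ;
  ms_map_smooth : forall i j, (i <= j)%N -> smooth_map (@ms_map j i) ;
  ms_map_id : forall i x, @ms_map i i x = x ;
  ms_map_comp : forall i j k x, (i <= j)%N -> (j <= k)%N ->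
    @ms_map j i (@ms_map k j x) = @ms_map k i x }.

Arguments ms_map _ _ _ _ : clear implicits.

Section Limit.
Variable M : preManifoldSystem.

Definition lim_pred : {pred prod_topology (fun i => M i)} := fun m =>
  `[< forall i j, (i <= j)%N -> ms_map M j i (m j) = m i >].

Record lim_space := LimSpace {
  lim_val : prod_topology (fun i => M i) ;
  limP : lim_val \in lim_pred }.
HB.instance Definition _ := [isSub for lim_val].
HB.instance Definition _ := [Choice of lim_space by <:].
HB.instance Definition _ := Topological.copy lim_space (initial_topology lim_val).
Definition lim_fun (x : lim_space) : forall i, M i := lim_val x.
Coercion lim_fun : lim_space >-> Funclass.

Definition lim_dom (c : forall i, chart (M i) (S i)) : set lim_space :=
  [set m : lim_space | forall i, chart_dom (c i) (m i)].

Definition lim_img (c : forall i, chart (M i) (S i)) : set (frechet S) :=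
  [set u : frechet S | exists2 m, lim_dom c m & forall i, u i = c i (m i)].

(** The openness of [lim_img c] is what makes the limit a chart of a Fréchet
    manifold; it does not follow from that of [lim_dom c]. *)
Definition lim_chart (c : forall i, chart (M i) (S i)) : Prop :=
  [/\ forall i, atlas (c i),
      forall i j, (i <= j)%N -> forall x, chart_dom (c j) x ->
        chart_dom (c i) (ms_map M j i x) /\
        c i (ms_map M j i x) = bs_map S j i (c j x),
      open (lim_dom c) &
      open (lim_img c) ].

End Limit.

Record manifoldSystem := ManifoldSystem {
  ms_base :> preManifoldSystem ;
  ms_charts : forall m : lim_space ms_base,
    exists2 c : forall i, chart (ms_base i) (S i), lim_chart c & lim_dom c m }.

End ManifoldSystem.
Arguments ms_map {R S} M j i _ : rename.

(** The class of [f o phi], for [f = repr s] a representative of [s]; relevant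
    when [phi] is smooth and [phi m' = m]. *)
Definition jet_pullback (R : realType) (E E' : completeNormedModType R)
    (N : banachManifold E) (N' : banachManifold E') (phi : N' -> N)
    (m : N) (m' : N') (s : jet2 m) : jet2 m' :=
  jet m' (repr s \o phi).

Section LimitDissection.
Context (R : realType) (S : banachSystem R) (M : manifoldSystem S).

Section LimJet.
Variable m : lim_space M.

Definition lim_jet2_pred : {pred prod_topology (fun i => jet2 (m i))} := fun s =>
  `[< forall i j, (i <= j)%N ->
      jet_pullback (ms_map M j i) (m j) (s i) = s j >].

(** The 2-jet at [m] of a function [f = lim f_i] on the limit is identified with
    the compatible family of the 2-jets of the [f_i] at the points [m i]. *)
Record lim_jet2 := LimJet2 {
  lim_jet2_val : prod_topology (fun i => jet2 (m i)) ;
  lim_jet2P : lim_jet2_val \in lim_jet2_pred }.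
HB.instance Definition _ := [isSub for lim_jet2_val].
HB.instance Definition _ := [Choice of lim_jet2 by <:].
HB.instance Definition _ :=
  Topological.copy lim_jet2 (initial_topology lim_jet2_val).
Definition lim_jet2_fun (x : lim_jet2) : forall i, jet2 (m i) := lim_jet2_val x.
Coercion lim_jet2_fun : lim_jet2 >-> Funclass.

End LimJet.

Definition lim_dissection_rep (G : hom2 S) :
    set (forall i, clin (S i) R^o * clin (S i) (clin (S i) R^o)) :=
  [set s : forall i, clin (S i) R^o * clin (S i) (clin (S i) R^o) |
    (forall i j, (i <= j)%N -> forall x, (s j).1 x = (s i).1 (bs_map S j i x)) /\
    (forall i, dissection_rep (G i) (s i))].

Definition is_lim_dissection (D : forall m : lim_space M, set (lim_jet2 m)) : Prop :=
  (forall m, zmod_closed [in [set lim_jet2_val s | s in D m]] /\ closed (D m)) /\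
  forall c : forall i, chart (M i) (S i), lim_chart c ->
    (* Gamma is the limit of the Gamma_ i *)
    exists (Gamma_ : forall i, S i -> clin (S i) (clin (S i) (S i)))
           (Gamma : frechet S -> hom2 S),
    [/\ forall i, smooth_on (chart_img (c i)) (Gamma_ i),
        frechet_smooth_on (lim_img c) Gamma,
        forall u, lim_img c u -> forall i,
          Gamma u i = Gamma_ i (u i) /\
          (forall x y, Gamma u i x y = Gamma u i y x) &
        forall m (u : frechet S), lim_dom c m -> (forall i, u i = c i (m i)) ->
          [set (fun i => jet_rep (c i) (s i)) | s in D m] =
          lim_dissection_rep (Gamma u) ].

Definition is_dissection_system
    (D : forall i (m : M i), set (jet2 m)) : Prop :=
  (forall i, is_dissection (D i)) /\
  forall (m : lim_space M) i j, (i <= j)%N -> forall s, D i (m i) s ->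
    D j (m j) (jet_pullback (ms_map M j i) (m j) s).

Definition lim_dissection (D : forall i (m : M i), set (jet2 m))
    (m : lim_space M) : set (lim_jet2 m) :=
  [set s : lim_jet2 m | forall i, D i (m i) (s i)].

End LimitDissection.

(* Main.v *)
From HB Require Import structures.
Require Import Defs.
From mathcomp Require Import all_boot all_order all_algebra.
From mathcomp Require Import all_classical all_reals all_analysis.

Set Implicit Arguments.
Unset Strict Implicit.
Unset Printing Implicit Defensive.
Import Order.TTheory GRing.Theory Num.Theory.
Import numFieldNormedType.Exports.
Local Open Scope classical_set_scope.
Local Open Scope ring_scope.

(** Fix a point [m] of the limit and charts [c i] around [m i] in which the
    connecting maps are the linear maps [rho] of the model spaces. There the
    dissection on the [i]-th manifold consists of the pairs [alpha], [alpha o G i]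
    with [G i] the value of the bilinear field [Gamma_ i], and the whole theorem
    rests on the fact that the [G i] are compatible: [G i o (rho, rho) = rho o G j].
    The pullback of a 2-jet along a map that is linear in charts is the
    composition of its two components with [rho] ([jet_pullback_rep]). So the jet
    [alpha], [alpha o G i] is sent to [alpha o rho], [alpha o G i o (rho, rho)].
    By hypothesis this belongs to the dissection on the [j]-th manifold, hence its
    second component is also [alpha o rho o G j]. This holds for all continuous
    functionals [alpha], and by the Hahn-Banach theorem ([clin_separates]) they
    separate points ([dissection_rep_compat]).

    The compatibility gives the limit field with values in H^2(F, F), and it also
    identifies the two sides of the last condition on a dissection of the limit: a
    family of jets in the dissections is determined by the functionals, and is a
    compatible family of jets as soon as the functionals are compatible
    ([lim_dissection_reps]). For the latter a jet has to be determined by its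
    expression in a single chart ([jet_rep_inj]), which is the chain rule of
    second order for the changes of charts.

    Smoothness of the limit field ([frechet_Ck_hom2]) is proved by induction on
    the order of differentiability: the directional derivatives are again given by
    a family of smooth maps between normed spaces, and they are compatible since
    compatibility is a closed linear condition on the difference quotients.
    Finally, the limit of closed subgroups is a closed subgroup as the pullback of
    jets is additive, which follows from its expression in charts. *)

(** * Bounded linear, bilinear and trilinear maps *)

Section BoundedMaps.
Context (R : realType).
Implicit Types A B C E F G : normedModType R.

Lemma bounded_clin E F (f : E -> F) (K : R) :
  linear f -> (forall x, `|f x| <= K * `|x|) -> f \in @clin_pred R E F.
Proof.
move=> lf bf; apply/asboolP; split => //.
pose fL : {linear E -> F} := HB.pack f (GRing.isLinear.Build R E F _ f lf).
apply: (@bounded_linear_continuous _ _ _ fL); apply/linear_boundedP.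
exists K; split; first exact: num_real.
by move=> L KL x; apply: le_trans (bf x) _; rewrite ler_wpM2r// ltW.
Qed.

Lemma ler_opnorm E F (f : clin E F) x : `|f x| <= `|f| * `|x|.
Proof.
have [->|x0] := eqVneq x 0; first by rewrite linear0 !normr0 mulr0.
have nx0 : 0 < `|x| by rewrite normr_gt0.
have := @ler_opnorm1 _ _ _ f (`|x|^-1 *: x).
rewrite normrZ normfV normr_id mulVf ?gt_eqF// => /(_ (lexx _)).
by rewrite linearZ normrZ normfV normr_id ler_pdivrMl// mulrC.
Qed.

Lemma opnorm_bound E F (f : clin E F) (K : R) :
  0 <= K -> (forall x, `|f x| <= K * `|x|) -> `|f| <= K.
Proof.
move=> K0 h; apply: opnorm_le => x x1; apply: le_trans (h x) _.
by rewrite ler_piMr.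
Qed.

Lemma clin_ext E F (f g : clin E F) : f =1 g -> f = g.
Proof. by move=> fg; apply/val_inj/funext. Qed.

Lemma bilinear_clin A B C (b : A -> B -> C) (K : R) :
  (forall y, linear (b^~ y)) -> (forall x, linear (b x)) -> 0 <= K ->
  (forall x y, `|b x y| <= K * `|x| * `|y|) ->
  exists beta : clin A (clin B C), forall x y, beta x y = b x y.
Proof.
move=> bl br K0 bb.
have bP x : b x \in @clin_pred R B C.
  exact: (@bounded_clin _ _ _ (K * `|x|)).
have lb : linear (fun x => Clin (bP x)).
  by move=> a u v; apply/clin_ext => y; exact: bl.
have cb : (fun x => Clin (bP x)) \in @clin_pred R A (clin B C).
  apply: (@bounded_clin _ _ _ K) => // x.
  by apply: opnorm_bound => [|y]; [exact: mulr_ge0|exact: bb].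
by exists (Clin cb).
Qed.

Lemma trilinear_clin A B C E (t : A -> B -> E -> C) (K : R) :
  (forall y z, linear (fun x => t x y z)) ->
  (forall x z, linear (fun y => t x y z)) ->
  (forall x y, linear (t x y)) -> 0 <= K ->
  (forall x y z, `|t x y z| <= K * `|x| * `|y| * `|z|) ->
  exists beta : clin A (clin B (clin E C)), forall x y z, beta x y z = t x y z.
Proof.
move=> t1 t2 t3 K0 tb.
have tP x y : t x y \in @clin_pred R E C.
  exact: (@bounded_clin _ _ _ (K * `|x| * `|y|)).
have [||x y|beta betaE] := @bilinear_clin A B (clin E C)
    (fun x y => Clin (tP x y)) K _ _ K0.
- by move=> y a u v; apply/clin_ext => z; exact: t1.
- by move=> x a u v; apply/clin_ext => z; exact: t2.
- by apply: opnorm_bound => [|z]; [rewrite !mulr_ge0|exact: tb].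
- by exists beta => x y z; rewrite betaE.
Qed.

Section Bilinear.
Context A B C (beta : clin A (clin B C)).

Lemma clin2P y : linear (fun x => beta x y).
Proof. by move=> a u v; rewrite linearP. Qed.

Lemma ler_opnorm2 x y : `|beta x y| <= `|beta| * `|x| * `|y|.
Proof.
apply: le_trans (ler_opnorm _ _) _.
by rewrite ler_wpM2r// ler_opnorm.
Qed.

Lemma clin2_continuous : continuous (fun p : A * B => beta p.1 p.2).
Proof.
move=> [x y]; rewrite /continuous_at /=.
have -> : (fun p : A * B => beta p.1 p.2) = (fun p =>
    beta (p.1 - x) (p.2 - y) + beta (p.1 - x) y + beta x p.2).
  apply/funext => p; rewrite -linearD subrK [beta (_ - _)]linearB/=.
  by rewrite [(_ - _) _]/(_ - _) subrK.
have cfst : (fun p : A * B => p.1 - x) @ (x, y) --> (0 : A).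
  rewrite -(subrr x); apply: cvgB; [exact: cvg_fst|exact: cvg_cst].
have csnd : (fun p : A * B => p.2 - y) @ (x, y) --> (0 : B).
  rewrite -(subrr y); apply: cvgB; [exact: cvg_snd|exact: cvg_cst].
have cprod : (fun p : A * B => `|beta| * `|p.1 - x| * `|p.2 - y|) @ (x, y)
    --> (0 : R).
  rewrite -[X in _ --> X](mulr0 (`|beta| * 0)).
  apply: cvgM; last by rewrite -(normr0 B); exact: cvg_norm.
  by apply: cvgMl_tmp; rewrite -(normr0 A); exact: cvg_norm.
rewrite -[X in _ --> X]add0r; apply: cvgD.
  rewrite -[X in _ --> X]add0r; apply: cvgD.
    apply/norm_cvg0P; apply: (squeeze_cvgr _ (cvg_cst 0) cprod).
    by near=> p; rewrite normr_ge0 ler_opnorm2.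
  have -> : 0 = beta 0 y :> C by rewrite linear0.
  apply: (@continuous_cvg _ _ _ _ _ _ (beta^~ y) (0 : A)) => //.
  have /asboolP[_] : (fun x' => beta x' y) \in @clin_pred R A C.
    apply: (@bounded_clin _ _ _ (`|beta| * `|y|)); first exact: clin2P.
    by move=> x'; rewrite mulrAC ler_opnorm2.
  exact.
by apply: continuous_cvg; [exact: clin_continuous|exact: cvg_snd].
Unshelve. all: by end_near. Qed.

(** The derivative of [beta f g] is the sum of [gamma f' g], with the [gamma] of
    this lemma, and of [gamma f g'], with that of the next one. That both are
    bilinear operations again is what lets the smoothness of products be proved by
    induction. *)
Lemma clin2_diffl E : exists gamma : clin (clin E A) (clin B (clin E C)),
  forall u y v, gamma u y v = beta (u v) y.
Proof.
apply: (@trilinear_clin (clin E A) B C E (fun u y v => beta (u v) y) `|beta|) => //.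
- by move=> y z a u v; rewrite clin_lcE linearP.
- by move=> x z a u v; rewrite linearP.
- by move=> x y a u v; rewrite !linearP.
- move=> u y v; apply: le_trans (ler_opnorm2 _ _) _.
  rewrite -!mulrA ler_wpM2l// (mulrC `|y|) mulrA.
  by rewrite ler_wpM2r// ler_opnorm.
Qed.

Lemma clin2_diffr E : exists gamma : clin A (clin (clin E B) (clin E C)),
  forall x u v, gamma x u v = beta x (u v).
Proof.
apply: (@trilinear_clin A (clin E B) C E (fun x u v => beta x (u v)) `|beta|) => //.
- by move=> y z a u v; rewrite linearP.
- by move=> x z a u v; rewrite clin_lcE linearP.
- by move=> x y a u v; rewrite !linearP.
- move=> x u v; apply: le_trans (ler_opnorm2 _ _) _.
  rewrite -!mulrA ler_wpM2l// ler_wpM2l//.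
  exact: ler_opnorm.
Qed.

End Bilinear.

(** The identity of [clin E F] is at the same time the evaluation of linear maps,
    as a bilinear operation. *)
Lemma clin_id E F : (id : clin E F -> clin E F) \in @clin_pred R (clin E F) (clin E F).
Proof. by apply: (@bounded_clin _ _ _ 1) => // f; rewrite mul1r. Qed.

Lemma clin_comp E F G : exists comp : clin (clin F G) (clin (clin E F) (clin E G)),
  forall g f v, comp g f v = g (f v).
Proof. by have [comp compE] := clin2_diffr (Clin (clin_id F G)) E; exists comp. Qed.

End BoundedMaps.

(** * Continuous linear functionals separate the points of a normed space *)

Section HahnBanach.
Context (R : realType) (E : normedModType R).

(** The graph of a linear functional, defined on a subspace and of norm at most
    one. Working with graphs makes the union of a chain of functionals the union
    of sets, so that Zorn's lemma for the inclusion applies; single-valuedness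
    follows from the bound. *)
Definition dominated_graph (G : set (E * R)) : Prop :=
  (forall (a : R) p q, G p -> G q -> G (a *: p.1 + q.1, a * p.2 + q.2)) /\
  (forall p, G p -> p.2 <= `|p.1|).

Lemma dominated_graph_fun G x r s : dominated_graph G ->
  G (x, r) -> G (x, s) -> r = s.
Proof.
move=> dG Gr Gs; have [lin dom] := dG.
have h u v : G (x, u) -> G (x, v) -> v <= u.
  move=> Gu Gv; have /dom/= := lin (-1) _ _ Gu Gv.
  by rewrite scaleN1r addNr normr0 mulN1r addrC subr_le0.
by apply/eqP; rewrite eq_le !h.
Qed.

(** The value [c] at the new point has to satisfy
    [r - |x - x0| <= c <= |y + x0| - s] for all [(x, r)] and [(y, s)] in the
    graph; the supremum of the left-hand sides does, by the triangle inequality.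
    Homogeneity reduces the bound at [x + t x0] to these two inequalities. *)
Lemma dominated_graph_extend G x0 : dominated_graph G -> G (0, 0) ->
  exists2 H, dominated_graph H & G `<=` H /\ exists c, H (x0, c).
Proof.
move=> [lin dom] G0.
pose L := [set p.2 - `|p.1 - x0| | p in G].
have Lub y s : G (y, s) -> ubound L (`|y + x0| - s).
  move=> Gy _ [[x r] Gx <-] /=; have /dom/= := lin 1 _ _ Gx Gy.
  rewrite scale1r mul1r => h; rewrite lerBlDr addrAC lerBrDr.
  apply: le_trans h _; have -> : x + y = (y + x0) + (x - x0).
    by rewrite addrC addrACA subrr addr0.
  exact: ler_normD.
have L0 : L !=set0 by exists (0 - `|0 - x0|); exists (0, 0).
have cL x r : G (x, r) -> r - `|x - x0| <= sup L.
  move=> Gx; apply: ub_le_sup; last by exists (x, r).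
  by exists (`|0 + x0| - 0); exact: Lub.
have cU y s : G (y, s) -> sup L <= `|y + x0| - s.
  by move=> Gy; apply: ge_sup => //; exact: Lub.
have Gz a x r : G (x, r) -> G (a *: x, a * r).
  by move=> Gx; have := lin a _ _ Gx G0; rewrite /= !addr0.
exists [set p | exists x r t, G (x, r) /\
    p = (x + t *: x0, r + t * sup L)]; last first.
  split=> [[x r] Gx|]; first by exists x, r, 0; rewrite scale0r mul0r !addr0.
  by exists (sup L), 0, 0, 1; rewrite scale1r mul1r !add0r.
split=> [a _ _ [x [r [t [Gx ->]]]] [y [s [w [Gy ->]]]]|_ [x [r [t [Gx ->]]]]] /=.
  exists (a *: x + y), (a * r + s), (a * t + w); split; first exact: (lin a _ _ Gx Gy).
  rewrite scalerDr mulrDr scalerDl mulrDl scalerA mulrA.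
  by congr (_, _); exact: addrACA.
have nZ (b : R) y : 0 < b -> b * `|y| = `|b *: y|.
  by move=> b0; rewrite normrZ gtr0_norm.
have [t0|t0|->] := ltgtP t 0; last by rewrite scale0r mul0r !addr0; exact: (dom _ Gx).
- have Nt0 : 0 < - t by rewrite oppr_gt0.
  have := cL _ _ (Gz (- t)^-1 _ _ Gx).
  rewrite -(ler_pM2l Nt0) mulrBr mulrA mulfV ?gt_eqF// mul1r nZ//.
  rewrite scalerBr scalerA mulfV ?gt_eqF// scale1r scaleNr opprK mulNr.
  by rewrite lerBlDr addrC lerBrDr.
- have := cU _ _ (Gz t^-1 _ _ Gx).
  rewrite -(ler_pM2l t0) mulrBr mulrA mulfV ?gt_eqF// mul1r nZ//.
  by rewrite scalerDr scalerA mulfV ?gt_eqF// scale1r lerBrDr addrC.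
Qed.

Lemma dominated_graph_line (x0 : E) :
  dominated_graph [set (t *: x0, t * `|x0|) | t in [set: R]].
Proof.
split=> [a _ _ [t _ <-] [w _ <-]|_ [t _ <-]] /=.
  by exists (a * t + w) => //; rewrite scalerDl mulrDl scalerA mulrA.
by rewrite normrZ ler_wpM2r// ler_norm.
Qed.

(** A consequence of the Hahn-Banach theorem: among the dominated graphs that
    contain the norming functional of the line through [x0], a maximal one is
    defined everywhere, since otherwise it could be extended to one more point. *)
Lemma clin_separates (x0 : E) : x0 != 0 -> exists f : clin E R^o, f x0 != 0.
Proof.
move=> x0N; pose l := [set (t *: x0, t * `|x0|) | t in [set: R]].
(* The union of the empty chain is empty, so that the line can only be required
   to lie in the nonempty graphs. *)
have [F FP tF|A [[dA lA] maxA]] := @Zorn_bigcup _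
    [set G | dominated_graph G /\ (G !=set0 -> l `<=` G)].
  split; last first.
    by move=> [p [G FG Gp]] q lq; exists G => //; apply: (FP _ FG).2 lq; exists p.
  split=> [a p q [G FG Gp] [H FH Hq]|p [G FG Gp]]; last first.
    by have [[_ dom] _] := FP _ FG; exact: dom.
  have [GH|HG] := tF _ _ FG FH.
  - by exists H => //; have [[lin _] _] := FP _ FH; apply: lin => //; exact: GH.
  - by exists G => //; have [[lin _] _] := FP _ FG; apply: lin => //; exact: HG.
have {}lA : l `<=` A.
  apply: lA; apply: contrapT => /nonemptyPn A0.
  apply: (maxA l); last by split=> [|_]; [exact: dominated_graph_line|].
  rewrite A0; split; first exact: sub0set.
  by move=> /(_ (0, 0)); apply; exists 0; rewrite // scale0r mul0r.
have A0 : A (0, 0) by apply: lA; exists 0; rewrite // scale0r mul0r.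
have domA x : exists r, A (x, r).
  have [H dH [AH [c Hc]]] := dominated_graph_extend x dA A0.
  apply: contrapT => nA; apply: (maxA H); last first.
    by split=> // _; exact: subset_trans AH.
  by split=> // HA; apply: nA; exists c; exact: HA.
have [f fA] := choice domA.
have flin : linear (f : E -> R^o).
  move=> a u v; apply: (dominated_graph_fun dA (fA _)).
  exact: (dA.1 a _ _ (fA u) (fA v)).
have fbd x : `|f x| <= `|x|.
  rewrite ler_norml (dA.2 _ (fA x)) andbT lerNl -normrN.
  have -> : - f x = f (- x) by have := flin (-1) x 0;
    rewrite !scaleN1r addr0 => ->; have := flin 0 0 0; rewrite !scale0r !add0r => h;
    rewrite (dominated_graph_fun dA (fA 0) A0) addr0.
  exact: (dA.2 _ (fA _)).
have fP : (f : E -> R^o) \in @clin_pred R E R^o.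
  by apply: (@bounded_clin _ _ _ _ 1) => // x; rewrite mul1r.
exists (Clin fP) => /=; have : A (x0, `|x0|).
  by apply: lA; exists 1; rewrite // scale1r mul1r.
by move=> /(dominated_graph_fun dA (fA x0)) ->; rewrite normr_eq0.
Qed.

End HahnBanach.

(** * Calculus of maps of class [C^n] between normed spaces *)

Section Calculus.
Context (R : realType).
Implicit Types E F G A B C : normedModType R.

Lemma Der_clin E F (f : clin E F) x : Der f x = f.
Proof.
by apply/val_inj; rewrite /= DerE ?diff_lin//;
  [exact: clin_continuous|exact/linear_differentiable/clin_continuous].
Qed.

Lemma differentiable_clin E F (f : clin E F) x : differentiable f x.
Proof. exact/linear_differentiable/clin_continuous. Qed.

Lemma Der_comp E F G (f : E -> F) (g : F -> G) x v :
  differentiable f x -> differentiable g (f x) ->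
  Der (g \o f) x v = Der g (f x) (Der f x v).
Proof.
move=> df dg; rewrite !DerE//; last exact: differentiable_comp.
by rewrite diff_comp.
Qed.

Lemma differentiable_Der_clin2 E A B C (beta : clin A (clin B C))
    (f : E -> A) (g : E -> B) x :
  differentiable f x -> differentiable g x ->
  differentiable (fun y => beta (f y) (g y)) x /\
  forall v, Der (fun y => beta (f y) (g y)) x v =
            beta (Der f x v) (g x) + beta (f x) (Der g x v).
Proof.
move=> df dg.
pose b : {bilinear A -> B -> C} := HB.pack (fun x y => beta x y)
  (bilinear_isBilinear.Build R A B C _ _ (fun x y => beta x y)
     (clin2P beta, fun x => clin_linear (beta x))).
have bc : continuous (fun p => b p.1 p.2) := clin2_continuous (beta := beta).
have dfg := differentiable_pair df dg.
have h : differentiable (fun y => beta (f y) (g y)) x.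
  exact: (differentiable_comp dfg (differentiable_bilin (f := b) _ bc)).
split=> // v; rewrite !DerE//.
have -> : (fun y => beta (f y) (g y)) = (fun p => b p.1 p.2) \o (fun y => (f y, g y)).
  by [].
rewrite diff_comp//; last exact: differentiable_bilin.
by rewrite diff_bilin//= diff_pair//= addrC.
Qed.

Lemma CkW n E F (U : set E) (f : E -> F) : Ck n.+1 U f -> Ck n U f.
Proof.
elim: n F f => [|n ih] F f [f1 f2].
  by move=> x Ux; apply: differentiable_continuous; exact: f1.
by split=> //; exact: ih.
Qed.

Lemma Ck_continuous n E F (U : set E) (f : E -> F) : Ck n U f ->
  forall x, U x -> {for x, continuous f}.
Proof. by elim: n => // n ih /CkW. Qed.

Lemma Ck_const n E F (U : set E) (a : F) : Ck n U (fun _ : E => a).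
Proof.
case: n => [|n] /=; first by move=> x _; exact: cvg_cst.
split=> [x _|]; first exact: differentiable_cst.
have -> : Der (fun _ : E => a) = 0.
  apply/funext => x; apply/val_inj; rewrite /= DerE; last exact: differentiable_cst.
  by rewrite diff_cst.
exact: Ck0.
Qed.

Lemma Ck_clin n E F (U : set E) (f : clin E F) : Ck n U f.
Proof.
case: n => [|n] /=; first by move=> x _; exact: clin_continuous.
split=> [x _|]; first exact: differentiable_clin.
have -> : Der f = fun=> f by apply/funext => x; exact: Der_clin.
exact: Ck_const.
Qed.

Lemma CkD n E F (U : set E) (f g : E -> F) : open U ->
  Ck n U f -> Ck n U g -> Ck n U (f + g).
Proof.
move=> oU hf hg; rewrite -[g]opprK -[- g]sub0r.
by apply: CkB => //; apply: CkB => //; exact: Ck0.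
Qed.

(** By the product rule the derivative is a sum of two expressions of the same
    shape, one order lower, for other bilinear maps; hence the induction has to
    range over all spaces and all [beta]. *)
Lemma Ck_clin2 n E A B C (U : set E) (beta : clin A (clin B C))
    (f : E -> A) (g : E -> B) : open U ->
  Ck n U f -> Ck n U g -> Ck n U (fun x => beta (f x) (g x)).
Proof.
move=> oU; elim: n A B C beta f g => [|n ih] A B C beta f g hf hg.
  move=> x Ux; apply: (@continuous_comp _ _ _ (fun y => (f y, g y))
    (fun p => beta p.1 p.2)); last exact: clin2_continuous.
  by apply: cvg_pair; [exact: hf|exact: hg].
have hf' := CkW hf; have hg' := CkW hg; case: hf hg => f1 f2 [g1 g2].
split=> [x Ux|].
  by have [] := differentiable_Der_clin2 beta (f1 x Ux) (g1 x Ux).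
have [bl blE] := clin2_diffl beta E; have [br brE] := clin2_diffr beta E.
apply: (@eq_Ck _ _ _ _ _
    ((fun x => bl (Der f x) (g x)) + (fun x => br (f x) (Der g x)))) => //.
  move=> x; rewrite inE => Ux; apply/clin_ext => v.
  have [_ ->] := differentiable_Der_clin2 beta (f1 x Ux) (g1 x Ux).
  by rewrite -blE -brE.
by apply: CkD => //; apply: ih.
Qed.

(** The derivative of [g o f] is the composition, a bounded bilinear operation, of
    [Der g o f] and [Der f]; the former is of class [C^n] by induction. *)
Lemma Ck_comp n E F G (U : set E) (V : set F) (f : E -> F) (g : F -> G) :
  open U -> {homo f : x / U x >-> V x} ->
  Ck n U f -> Ck n V g -> Ck n U (g \o f).
Proof.
move=> oU fUV; elim: n G g => [|n ih] G g hf hg.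
  by move=> x Ux; apply: continuous_comp; [exact: hf|exact/hg/fUV].
have hf' := CkW hf; case: hf hg => f1 f2 [g1 g2]; split=> [x Ux|].
  by apply: differentiable_comp; [exact: f1|exact/g1/fUV].
have [comp compE] := @clin_comp R E F G.
apply: (@eq_Ck _ _ _ _ _ (fun x => comp ((Der g \o f) x) (Der f x))) => //.
  move=> x; rewrite inE => Ux; apply/clin_ext => v.
  by rewrite compE Der_comp//; [exact: f1|exact/g1/fUV].
by apply: Ck_clin2 => //; exact: ih.
Qed.

End Calculus.

(** * Change of charts and pullback for 2-jets *)

Lemma clinDE (R : realType) (E F : normedModType R) (f g : clin E F) x :
  (f + g) x = f x + g x.
Proof. by []. Qed.

Lemma clinNE (R : realType) (E F : normedModType R) (f : clin E F) x :
  (- f) x = - f x.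
Proof. by []. Qed.

Section SecondOrder.
Context (R : realType) (E F G : normedModType R).

(** The product rule, applied to the expression of [Der (g o f)] as the bilinear
    composition of [Der g o f] and [Der f]. *)
Lemma Der2_comp (U : set E) (V : set F) (f : E -> F) (g : F -> G) x v w :
  open U -> U x -> {homo f : y / U y >-> V y} -> Ck 2 U f -> Ck 2 V g ->
  Der (Der (g \o f)) x v w =
  Der (Der g) (f x) (Der f x v) (Der f x w) + Der g (f x) (Der (Der f) x v w).
Proof.
move=> oU Ux fUV [f1 [f2 _]] [g1 [g2 _]].
have [comp compE] := @clin_comp R E F G.
have dgf : differentiable (Der g \o f) x.
  by apply: differentiable_comp; [exact: f1|exact/g2/fUV].
have [dc cE] := differentiable_Der_clin2 comp dgf (f2 x Ux).
have e : \near x, comp ((Der g \o f) x) (Der f x) = Der (g \o f) x.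
  have : \forall y \near x, U y by exact: open_nbhs_nbhs.
  apply: filterS => y Uy; apply/clin_ext => z.
  by rewrite compE Der_comp//; [exact: f1|exact/g1/fUV].
rewrite -(near_eq_Der e dc) cE clinDE.
by rewrite !compE/= Der_comp//; [exact: f1|exact/g2/fUV].
Qed.

End SecondOrder.

Section ChartLemmas.
Context (R : realType) (T : topologicalType) (E : normedModType R).
Variable c : chart T E.

Lemma chart_inv_dom x : chart_img c x -> chart_dom c (chart_inv c x).
Proof. by move=> [m cm <-]; rewrite chart_funK ?inE. Qed.

Lemma chart_invK x : chart_img c x -> c (chart_inv c x) = x.
Proof. by move=> [m cm <-]; rewrite chart_funK ?inE. Qed.

End ChartLemmas.

Lemma open_preimage_in (T T' : topologicalType) (U : set T) (V : set T')
    (f : T -> T') : open U -> (forall x, U x -> {for x, continuous f}) ->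
  open V -> open (U `&` f @^-1` V).
Proof.
move=> oU fc oV; rewrite openE => x [Ux Vfx].
apply: filterI; first exact: open_nbhs_nbhs.
by apply: (fc x Ux); exact: open_nbhs_nbhs.
Qed.

Section Pullback.
Context (R : realType) (E E' : completeNormedModType R).
Context (N : banachManifold E) (N' : banachManifold E').
Variables (phi : N' -> N) (m' : N').
Hypothesis smooth_phi : smooth_map phi.

(** Near [m'] the map [phi] is determined by its expression in the charts; all
    functions [f o phi] are studied through it, as
    [f o phi o d^-1 = (f o c^-1) o (c o phi o d^-1)] on [W]. *)
Lemma local_expression (c : chart N E) (d : chart N' E') :
  chart_at (phi m') c -> chart_at m' d ->
  exists W, [/\ open_nbhs (d m') W, smooth_on W (c \o phi \o chart_inv d),
    (c \o phi \o chart_inv d) (d m') = c (phi m') &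
    forall x, W x -> chart_inv c (c (phi (chart_inv d x))) = phi (chart_inv d x)].
Proof.
move=> [ac cm] [ad dm]; have [phiC phiS] := smooth_phi.
exists (d @` (chart_dom d `&` phi @^-1` chart_dom c)); split.
- split; last by exists m'.
  have -> : d @` (chart_dom d `&` phi @^-1` chart_dom c) =
      chart_img d `&` (phi \o chart_inv d) @^-1` chart_dom c.
    apply/seteqP; split=> [_ [y [dy cy] <-]|_ [[y dy <-]]] /=.
      by split; [exists y|rewrite /= chart_funK ?inE].
    by rewrite chart_funK ?inE// => cy; exists y.
  apply: open_preimage_in; [exact: chart_imgO| |exact: chart_domO].
  move=> x dx; apply: continuous_comp; last exact: phiC.
  by apply: chart_invC; rewrite inE.
- exact: phiS.
- by rewrite /= chart_funK ?inE.
- by move=> _ [y [dy cy] <-]; rewrite !chart_funK ?inE.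
Qed.

Lemma germ_smooth (m : N) (f : N -> R^o) (c : chart N E) : f \in local_fun m ->
  chart_at m c -> exists2 V, open_nbhs (c m) V & smooth_on V (f \o chart_inv c).
Proof. by move=> /asboolP[_]; exact. Qed.

Lemma local_fun_comp (f : N -> R^o) :
  f \in local_fun (phi m') -> f \o phi \in local_fun m'.
Proof.
move=> fP; have /asboolP[f0 _] := fP; apply/asboolP; split=> // d dm.
have [c ac cm] := atlas_cover (phi m').
have [V [oV Vc] fV] := germ_smooth fP (conj ac cm).
have [W [[oW Wd] phiW phid WE]] := local_expression (conj ac cm) dm.
pose W' := W `&` (c \o phi \o chart_inv d) @^-1` V.
have oW' : open W'.
  by apply: open_preimage_in => //; exact: Ck_continuous (phiW 0%N).
exists W'; first by split=> //; split=> //; rewrite /preimage/= in phid *; rewrite phid.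
move=> n; apply: (@eq_Ck _ _ _ _ _ ((f \o chart_inv c) \o (c \o phi \o chart_inv d))) => //.
  by move=> x; rewrite inE => -[Wx _] /=; rewrite WE.
apply: (Ck_comp (V := V)) => //; first by move=> x [].
by apply: CkS (phiW n); exact: subIsetl.
Qed.


(** The sign of the last term comes from the convention that the second component
    of a jet is minus the second derivative. *)
Lemma jet_rep_fun_comp (f : N -> R^o) (c : chart N E) (d : chart N' E') :
  f \in local_fun (phi m') -> chart_at (phi m') c -> chart_at m' d ->
  let h := c \o phi \o chart_inv d in
  let s := jet_rep_fun (phi m') c f in
  let s' := jet_rep_fun m' d (f \o phi) in
  (forall v, s'.1 v = s.1 (Der h (d m') v)) /\
  (forall v w, s'.2 v w = s.2 (Der h (d m') v) (Der h (d m') w)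
                          - s.1 (Der (Der h) (d m') v w)).
Proof.
move=> fP cm dm h s s'.
have [V [oV Vc] fV] := germ_smooth fP cm.
have [W [[oW Wd] hW hd WE]] := local_expression cm dm.
have hd' : h (d m') = c (phi m') := hd.
pose W' := W `&` h @^-1` V.
have oW' : open W'.
  by apply: open_preimage_in => //; exact: Ck_continuous (hW 0%N).
have W'd : W' (d m') by split=> //; have := Vc; rewrite -hd'.
have hW' : Ck 2 W' h by apply: CkS (hW 2); exact: subIsetl.
have hWV : {homo h : x / W' x >-> V x} by move=> x [].
have e x : W' x -> ((f \o chart_inv c) \o h) x = ((f \o phi) \o chart_inv d) x.
  by move=> [Wx _] /=; rewrite WE.
have C2 := Ck_comp oW' hWV hW' (fV 2).
have nW' x : W' x -> \forall y \near x, W' y by move=> ?; exact: open_nbhs_nbhs.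
have e1 x : W' x ->
    Der ((f \o chart_inv c) \o h) x = Der ((f \o phi) \o chart_inv d) x.
  move=> Wx; apply: near_eq_Der; last exact: C2.1.
  by apply: filterS (nW' x Wx); exact: e.
have e2 : Der (Der ((f \o chart_inv c) \o h)) (d m') =
    Der (Der ((f \o phi) \o chart_inv d)) (d m').
  apply: near_eq_Der; last exact: C2.2.1.
  by apply: filterS (nW' _ W'd); exact: e1.
split=> [v|v w].
  rewrite /s' /s /= -e1// Der_comp ?hd'//; first exact: hW'.1.
  by rewrite -hd'; apply: (fV 1).1; exact: hWV.
rewrite -[LHS]/(- Der (Der ((f \o phi) \o chart_inv d)) (d m') v w).
rewrite -e2 (Der2_comp _ _ oW' W'd hWV hW' (fV 2)) hd'.
by rewrite opprD.
Qed.

End Pullback.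

Section Jets.
Context (R : realType) (E : completeNormedModType R) (N : banachManifold E).
Implicit Type m : N.

Lemma smooth_map_id : smooth_map (id : N -> N).
Proof.
by split=> [m|c d ac ad]; [exact: cvg_id|exact: atlas_compatible].
Qed.

(** Changing charts is the pullback along the identity map, and the formula for
    the pullback is linear in the derivatives of [f]. *)
Lemma flat2_chart m (f : germ m) c : chart_at m c ->
  jet_rep_fun m c f = 0 -> f \in flat2 (m := m).
Proof.
move=> cm f0; apply/asboolP => d dm.
have [e1 e2] := jet_rep_fun_comp smooth_map_id (germP f) cm dm.
rewrite f0 in e1 e2.
rewrite [LHS]surjective_pairing; congr pair; apply/clin_ext => v.
  exact: e1.
by apply/clin_ext => w; rewrite (e2 v w) subr0.
Qed.

(** [f] and the representative chosen for its class differ by a flat germ. *)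
Lemma repr_piP m c (f : germ m) : chart_at m c ->
  jet_rep_fun m c (repr (\pi_(jet2 m)%qT f)) = jet_rep_fun m c f.
Proof.
move=> cm; have : repr (\pi_(jet2 m)%qT f) - f \in flat2 (m := m).
  by rewrite Quotient.idealrBE reprK.
by move=> /asboolP/(_ c cm); rewrite jet_rep_funB// => /eqP; rewrite subr_eq0 => /eqP.
Qed.

Lemma jet_repE m c (f : N -> R^o) : chart_at m c -> f \in local_fun m ->
  jet_rep c (jet m f) = jet_rep_fun m c f.
Proof.
move=> cm fP; rewrite /jet_rep /jet; case: insubP => [g _ gf|]; last by rewrite fP.
by rewrite repr_piP// -gf.
Qed.

Lemma jet_repB m c (s t : jet2 m) : chart_at m c ->
  jet_rep c (s - t) = jet_rep c s - jet_rep c t.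
Proof.
move=> cm; rewrite /jet_rep -jet_rep_funB// -(repr_piP (repr s - repr t) cm).
suff -> : \pi_(jet2 m)%qT (repr s - repr t) = s - t by [].
by rewrite -[s in RHS]reprK -[t in RHS]reprK; exact: pi_is_zmod_morphism.
Qed.

Lemma jet_rep_inj m c : chart_at m c -> injective (jet_rep c : jet2 m -> _).
Proof.
move=> cm s t st; rewrite -[s]reprK -[t]reprK; apply/eqP.
rewrite -Quotient.idealrBE; apply: (flat2_chart cm).
by rewrite jet_rep_funB//; apply/eqP; rewrite subr_eq0; apply/eqP.
Qed.

End Jets.

(** * Smooth maps into the limit of the spaces of bilinear maps *)

Lemma openX (T T' : topologicalType) (U : set T) (V : set T') :
  open U -> open V -> open (U `*` V).
Proof.
move=> oU oV; rewrite openE => -[x y] [Ux Vy].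
by exists (U, V) => //; split; exact: open_nbhs_nbhs.
Qed.

Section LimitTopologies.

Lemma cvg_initial (S : choiceType) (T : topologicalType) (f : S -> T)
    (F : set_system S) (x : initial_topology f) : Filter F ->
  f @ F --> f x -> F --> x.
Proof.
move=> FF fF A; rewrite nbhsE => -[B [[C oC <-] Cx] BA].
apply: filterS BA _; apply: fF; exact: open_nbhs_nbhs.
Qed.

Lemma cvg_prod_topology (I : Type) (V : I -> topologicalType)
    (F : set_system (prod_topology V)) (x : prod_topology V) : Filter F ->
  (forall i, (fun y : prod_topology V => y i) @ F --> x i) -> F --> x.
Proof.
by move=> FF h; apply/cvg_sup => i; exact: cvg_initial (h i).
Qed.

Lemma proj_prod_continuous (I : eqType) (V : I -> topologicalType) (i : I) :
  continuous (fun x : prod_topology V => x i).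
Proof. exact: proj_continuous. Qed.

End LimitTopologies.

Section FrechetSpaces.
Context (R : realType) (S : banachSystem R).

Lemma frechet_proj_continuous i : continuous (fun x : frechet S => x i).
Proof.
move=> x; apply: (@continuous_comp (frechet S) _ _ (@frechet_val R S)
  (fun y : prod_topology (fun i => S i) => y i)).
  exact: initial_continuous.
exact: proj_prod_continuous.
Qed.

Lemma frechet_cvg (T : Type) (F : set_system T) (f : T -> frechet S) (l : frechet S) :
  Filter F -> (forall i, (fun t => f t i) @ F --> l i) -> f @ F --> l.
Proof. by move=> FF h; apply: cvg_initial; apply: cvg_prod_topology => i; exact: h. Qed.

Lemma hom2_cvg (T : Type) (F : set_system T) (f : T -> hom2 S) (l : hom2 S) :
  Filter F -> (forall i, (fun t => f t i) @ F --> l i) -> f @ F --> l.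
Proof. by move=> FF h; apply: cvg_initial; apply: cvg_prod_topology => i; exact: h. Qed.

Lemma frechet_line_cvg (x v : frechet S) :
  (fun t : R => x + t *: v) @ (0 : R)^' --> x.
Proof.
apply: frechet_cvg => i.
rewrite -[X in _ --> X]addr0 -(scale0r (v i)).
apply: cvgD; first exact: cvg_cst.
by apply: cvgZr_tmp; apply: cvg_within_filter; exact: cvg_id.
Qed.

Lemma clin_eval_cvg (E G : normedModType R) (T : Type) (F : set_system T)
    (f : T -> clin E G) (l : clin E G) x : Filter F ->
  f @ F --> l -> (fun t => f t x) @ F --> l x.
Proof.
move=> FF fl; have /asboolP[_ evx] :
    (fun g : clin E G => g x) \in @clin_pred R (clin E G) G.
  apply: (@bounded_clin _ _ _ _ `|x|) => [a g h|g]; first exact: clin_lcE.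
  by rewrite mulrC ler_opnorm.
exact: (continuous_cvg _ (evx l) fl).
Qed.

(** The evaluations and the maps of the system are continuous, so that both sides
    of each compatibility condition pass to the limit. *)
Lemma hom2_pred_lim (T : Type) (F : set_system T) (f : T -> hom2 S)
    (l : prod_topology (fun i => clin (S i) (clin (S i) (S i)))) :
  ProperFilter F -> (forall i, (fun t => f t i) @ F --> l i) -> l \in @hom2_pred R S.
Proof.
move=> FF fl; apply/asboolP => i j ij x y.
have ev k (a b : S k) : (fun t => f t k a b) @ F --> l k a b.
  by do 2 apply: clin_eval_cvg; exact: fl.
have evr : (fun t => bs_map S j i (f t j x y)) @ F --> bs_map S j i (l j x y).
  by apply: continuous_cvg; [exact: clin_continuous|exact: ev].
apply: (cvg_unique _ (ev _ _ _)) => //.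
rewrite [X in X @ _](_ : _ = fun t => bs_map S j i (f t j x y))//.
by apply/funext => t; have /asboolP := hom2P (f t); exact.
Qed.

End FrechetSpaces.

Section FrechetSmoothness.
Context (R : realType) (S : banachSystem R).

Lemma Der_quotient_cvg (E G : normedModType R) (f : E -> G) x v :
  differentiable f x ->
  (fun t : R => t^-1 *: (f (x + t *: v) - f x)) @ 0^' --> Der f x v.
Proof.
move=> df; rewrite DerE// -deriveE//.
have -> : (fun t : R => t^-1 *: (f (x + t *: v) - f x)) =
    (fun t : R => t^-1 *: ((f \o shift x) (t *: v) - f x)).
  by rewrite funeqE => t /=; rewrite [x + _]addrC.
exact: diff_derivable.
Qed.

Lemma Ck_Der_pair n (E G : normedModType R) (U : set E) (f : E -> G) : open U ->
  smooth_on U f -> Ck n (U `*` setT) (fun z : E * E => Der f z.1 z.2).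
Proof.
move=> oU fS.
have fstP : (fst : E * E -> E) \in @clin_pred R (E * E)%type E.
  by apply/asboolP; split=> // z; exact: cvg_fst.
have sndP : (snd : E * E -> E) \in @clin_pred R (E * E)%type E.
  by apply/asboolP; split=> // z; exact: cvg_snd.
have oUT := openX oU (@openT E).
apply: (@Ck_clin2 _ _ _ _ _ _ _ (Clin (clin_id E G)) (Der f \o Clin fstP) (Clin sndP)) => //.
  apply: (Ck_comp (V := U)) => //; [by move=> x []|exact: Ck_clin|].
  exact: (fS n.+1).2.
exact: Ck_clin.
Qed.

Lemma continuous_hom2 (X : topologicalType) (Y : nat -> normedModType R)
    (p : forall i, X -> Y i) (U : set X)
    (f : forall i, Y i -> clin (S i) (clin (S i) (S i))) (g : X -> hom2 S) :
  open U -> (forall i, continuous (p i)) ->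
  (forall i x, U x -> {for p i x, continuous (f i)}) ->
  (forall x, U x -> forall i, g x i = f i (p i x)) ->
  forall x, U x -> {for x, continuous g}.
Proof.
move=> oU pc fc gf x Ux; apply: hom2_cvg => i; rewrite gf//.
have fpc : {for x, continuous (f i \o p i)}.
  by apply: continuous_comp; [exact: pc|exact: fc].
apply: cvg_trans fpc; apply: near_eq_cvg.
have : \forall y \near x, U y by exact: open_nbhs_nbhs.
by apply: filterS => y Uy; rewrite gf.
Qed.

(** The derivative of [g] is given by the derivatives of the [f i], and lives on
    [X * X]; for the induction the domain [X] is therefore not the limit of the
    Banach spaces, but any space with linear maps [p i] to normed spaces. The
    derivative takes its values in [hom2 S] as a limit of difference quotients of
    [g]; the [f i] alone would not give this, because the points of [V i] need not
    come from [U]. *)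
Lemma frechet_Ck_hom2 n (X : preTopologicalLmodType R) (Y : nat -> normedModType R)
    (p : forall i, X -> Y i) (U : set X) (V : forall i, set (Y i))
    (f : forall i, Y i -> clin (S i) (clin (S i) (S i))) (g : X -> hom2 S) :
  open U -> (forall x v : X, (fun t : R => x + t *: v) @ 0^' --> x) ->
  (forall i, linear (p i)) -> (forall i, continuous (p i)) ->
  (forall i, open (V i)) -> (forall i x, U x -> V i (p i x)) ->
  (forall i, smooth_on (V i) (f i)) ->
  (forall x, U x -> forall i, g x i = f i (p i x)) ->
  frechet_Ck n U g.
Proof.
elim: n X Y p U V f g => [|n ih] X Y p U V f g oU lineU pl pc oV UV fS gf;
  have gc := continuous_hom2 oU pc
    (fun i x Ux => Ck_continuous (fS i 0%N) (UV i x Ux)) gf.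
  by split.
split=> //.
have df i x : U x -> differentiable (f i) (p i x).
  by move=> Ux; apply: (fS i 1%N).1; exact: UV.
have nearU x v : U x -> \forall t \near (0 : R)^', U (x + t *: v).
  by move=> Ux; apply: (lineU x v); exact: open_nbhs_nbhs.
have quot x v i : U x ->
    (fun t : R => (t^-1 *: (g (x + t *: v) - g x)) i) @ 0^' -->
    Der (f i) (p i x) (p i v).
  move=> Ux; apply: cvg_trans (Der_quotient_cvg (v := p i v) (df i x Ux)).
  apply: near_eq_cvg; apply: filterS (nearU x v Ux) => t Ut.
  have -> : p i x + t *: p i v = p i (x + t *: v).
    by rewrite addrC -pl addrC.
  by rewrite -!gf.
have dg z : exists h : hom2 S, U z.1 -> forall i, h i = Der (f i) (p i z.1) (p i z.2).
  have [Uz|nUz] := pselect (U z.1); last by exists 0.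
  have hP := hom2_pred_lim (l := fun i => Der (f i) (p i z.1) (p i z.2))
    (Proper_dnbhs_numFieldType 0) (fun i => quot z.1 z.2 i Uz).
  by exists (Hom2 hP).
have [dgf dgE] := choice dg.
exists dgf; split=> [x v Ux|].
  by apply: hom2_cvg => i; rewrite dgE//; exact: quot.
apply: (ih _ (fun i => (Y i * Y i)%type) (fun i z => (p i z.1, p i z.2)) _
          (fun i => V i `*` setT) (fun i z => Der (f i) z.1 z.2)).
- exact: openX oU openT.
- by move=> z w; exact: (cvg_pair (lineU z.1 w.1) (lineU z.2 w.2)).
- by move=> i a u v; congr pair; exact: pl.
- move=> i z; apply: cvg_pair.
    by apply: continuous_comp; [exact: cvg_fst|exact: pc].
  by apply: continuous_comp; [exact: cvg_snd|exact: pc].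
- by move=> i; exact: openX (oV i) openT.
- by move=> i x [Ux _]; split=> //; exact: UV.
- by move=> i k; apply: Ck_Der_pair => //; exact: fS.
- by move=> x [Ux _] i; exact: dgE.
Qed.

End FrechetSmoothness.

(** * Pullback along maps that are linear in charts *)

Section LinearPullback.
Context (R : realType) (E E' : completeNormedModType R).
Context (N : banachManifold E) (N' : banachManifold E').
Variables (phi : N' -> N) (m : N) (m' : N').
Variables (c : chart N E) (d : chart N' E') (rho : clin E' E).
Hypotheses (smooth_phi : smooth_map phi) (phim : phi m' = m).
Hypotheses (cm : chart_at m c) (dm : chart_at m' d).
Hypothesis phi_rho : forall x, chart_dom d x ->
  chart_dom c (phi x) /\ c (phi x) = rho (d x).

(** In these charts [phi] is [rho], whose derivative is constant: the term with the
    second derivative of [phi] disappears. *)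
Lemma jet_pullback_rep (s : jet2 m) :
  let s' := jet_pullback phi m' s in
  (forall v, (jet_rep d s').1 v = (jet_rep c s).1 (rho v)) /\
  (forall v w, (jet_rep d s').2 v w = (jet_rep c s).2 (rho v) (rho w)).
Proof.
move=> s'; subst m.
have fP := germP (repr s).
have Der_h x : chart_img d x -> Der (c \o phi \o chart_inv d) x = rho.
  move=> dx; rewrite -[RHS](Der_clin rho x).
  apply/esym/near_eq_Der; last exact: differentiable_clin.
  have : \forall y \near x, chart_img d y.
    by apply: open_nbhs_nbhs; split=> //; exact: chart_imgO.
  apply: filterS => y dy /=.
  by have [_ ->] := phi_rho (chart_inv_dom dy); rewrite chart_invK.
have dm' : chart_img d (d m') by exists m' => //; exact: dm.2.
have Der2_h : Der (Der (c \o phi \o chart_inv d)) (d m') = 0.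
  have : \forall y \near d m', (fun=> rho) y = Der (c \o phi \o chart_inv d) y.
    have : \forall y \near d m', chart_img d y.
      by apply: open_nbhs_nbhs; split=> //; exact: chart_imgO.
    by apply: filterS => y dy; rewrite Der_h.
  move=> /near_eq_Der <-; last exact: differentiable_cst.
  by apply/clin_ext => v; rewrite DerE ?diff_cst//; exact: differentiable_cst.
have [e1 e2] := jet_rep_fun_comp smooth_phi fP cm dm.
have s'E : jet_rep d s' = jet_rep_fun m' d (repr s \o phi).
  by apply: jet_repE => //; exact: local_fun_comp.
split=> [v|v w]; rewrite s'E; first by rewrite e1 Der_h.
by rewrite e2 Der_h// Der2_h /= linear0 subr0.
Qed.

(** The pullback is defined by representatives, which are not chosen additively;
    its expression in charts, however, is additive in the jet. *)
Lemma jet_pullbackB (s t : jet2 m) :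
  jet_pullback phi m' (s - t) = jet_pullback phi m' s - jet_pullback phi m' t.
Proof.
have [st1 st2] := jet_pullback_rep (s - t).
have [s1 s2] := jet_pullback_rep s; have [t1 t2] := jet_pullback_rep t.
have rep_sub1 (K : normedModType R) (a b : clin K R^o * clin K (clin K R^o)) v :
  (a - b).1 v = a.1 v - b.1 v.
  by rewrite -[(a - b).1]/(a.1 + - b.1) clinDE clinNE.
have rep_sub2 (K : normedModType R) (a b : clin K R^o * clin K (clin K R^o)) v w :
  (a - b).2 v w = a.2 v w - b.2 v w.
  by rewrite -[(a - b).2]/(a.2 + - b.2) !clinDE !clinNE.
apply: (jet_rep_inj dm); rewrite jet_repB//.
rewrite [LHS]surjective_pairing; congr pair; apply/clin_ext => v.
  by rewrite st1 jet_repB// rep_sub1 -s1 -t1.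
by apply/clin_ext => w; rewrite st2 jet_repB// rep_sub2 -s2 -t2.
Qed.

Lemma jet_pullback0 : jet_pullback phi m' (0 : jet2 m) = 0.
Proof. by rewrite -[in LHS](subr0 0) jet_pullbackB subrr. Qed.

(** For each [alpha] the jet with components [alpha] and [alpha o G] is in [D]. Its
    pullback has components [alpha o rho] and [alpha o G o (rho, rho)], and is of
    the form given by [H], so that [alpha o G o (rho, rho) = alpha o rho o H].
    Continuous functionals separate points. *)
Lemma dissection_rep_compat (D : set (jet2 m)) (D' : set (jet2 m'))
    (G : clin E (clin E E)) (H : clin E' (clin E' E')) :
  [set jet_rep c s | s in D] = dissection_rep G ->
  [set jet_rep d s | s in D'] = dissection_rep H ->
  (forall s, D s -> D' (jet_pullback phi m' s)) ->
  forall x y, G (rho x) (rho y) = rho (H x y).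
Proof.
move=> DG DH DD' x y; apply: contrapT => /eqP.
rewrite -subr_eq0 => /clin_separates[alpha]; rewrite linearB/= => /eqP; apply.
have [|||u v|beta betaE] := @bilinear_clin R E E R^o (fun u v => alpha (G u v))
    (`|alpha| * `|G|).
- by move=> v a u w; rewrite !linearP.
- by move=> u a v w; rewrite !linearP.
- exact: mulr_ge0.
- apply: le_trans (ler_opnorm _ _) _; rewrite -!mulrA ler_wpM2l// mulrA.
  exact: ler_opnorm2.
have : dissection_rep G (alpha, beta) by move=> u v; rewrite betaE.
rewrite -DG => -[s Ds sE].
have : dissection_rep H (jet_rep d (jet_pullback phi m' s)).
  by rewrite -DH; exists (jet_pullback phi m' s) => //; exact: DD'.
have [s1 s2] := jet_pullback_rep s.
by move=> /(_ x y); rewrite s1 s2 sE /= betaE => ->; rewrite subrr.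
Qed.

End LinearPullback.

(** * The limit of a system of dissections *)

Section LimitDissection.
Context (R : realType) (S : banachSystem R) (M : manifoldSystem S).

Lemma lim_fun_map (m : lim_space M) i j : (i <= j)%N -> ms_map M j i (m j) = m i.
Proof. by move: i j; have /asboolP := limP m. Qed.

Lemma lim_chart_at (m : lim_space M) c i :
  lim_chart c -> lim_dom c m -> chart_at (m i) (c i).
Proof. by move=> [ac _ _ _] cm; split; [exact: ac|exact: cm]. Qed.

Lemma lim_jet2_pred_zmod (m : lim_space M) : zmod_closed (@lim_jet2_pred R S M m).
Proof.
have [c cL cm] := ms_charts m; have [_ cE _ _] := cL.
split=> [|s t /asboolP sC /asboolP tC]; apply/asboolP => i j ij.
  exact: (jet_pullback0 (ms_map_smooth M ij) (lim_fun_map m ij)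
    (lim_chart_at i cL cm) (lim_chart_at j cL cm) (cE i j ij)).
rewrite -[RHS]/(s j - t j) -(sC i j ij) -(tC i j ij).
exact: (jet_pullbackB (ms_map_smooth M ij) (lim_fun_map m ij)
  (lim_chart_at i cL cm) (lim_chart_at j cL cm) (cE i j ij)).
Qed.

Lemma lim_jet2_proj_continuous (m : lim_space M) i :
  continuous (fun s : lim_jet2 m => s i).
Proof.
move=> s; apply: (@continuous_comp (lim_jet2 m) _ _ (@lim_jet2_val R S M m)
  (fun y : prod_topology (fun i => jet2 (m i)) => y i)).
  exact: initial_continuous.
exact: proj_prod_continuous.
Qed.

Variable D : forall i (m : M i), set (jet2 m).
Hypothesis hD : is_dissection_system D.

Lemma lim_dissection_group (m : lim_space M) :
  zmod_closed [in [set lim_jet2_val s | s in lim_dissection D (m := m)]].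
Proof.
have [P0 PB] := lim_jet2_pred_zmod m.
have Dz i : zmod_closed [in @D i (m i)] by have [/(_ (m i))[]] := hD.1 i.
split=> [|x y]; rewrite !inE.
  exists (LimJet2 P0) => // i; have [+ _] := Dz i; rewrite inE; exact.
move=> [s Ds <-] [t Dt <-]; exists (LimJet2 (PB _ _ (lim_jet2P s) (lim_jet2P t))) => //.
move=> i; have [_ /(_ (s i) (t i))] := Dz i; rewrite !inE; apply; [exact: Ds|exact: Dt].
Qed.

Lemma lim_dissection_closed (m : lim_space M) : closed (lim_dissection D (m := m)).
Proof.
have -> : lim_dissection D (m := m) =
    \bigcap_i ((fun s : lim_jet2 m => s i) @^-1` @D i (m i)).
  by apply/seteqP; split=> [s Ds i _|s Ds i]; [exact: Ds|exact: Ds].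
apply: closed_bigI => i _; apply: preimage_closed.
  by move=> s _; exact: lim_jet2_proj_continuous.
by have [/(_ (m i))[]] := hD.1 i.
Qed.

Section Chart.
Variable c : forall i, chart (M i) (S i).
Hypothesis cL : lim_chart c.
Variable Gamma_ : forall i, S i -> clin (S i) (clin (S i) (S i)).
Hypothesis GammaE : forall i m, chart_dom (c i) m ->
  [set jet_rep (c i) s | s in @D i m] = dissection_rep (Gamma_ (c i m)).

Lemma Gamma_compat (m : lim_space M) : lim_dom c m ->
  (fun i => Gamma_ (c i (m i))) \in @hom2_pred R S.
Proof.
move=> cm; have [_ cE _ _] := cL; apply/asboolP => i j ij.
apply: (dissection_rep_compat (ms_map_smooth M ij) (lim_fun_map m ij)
  (lim_chart_at i cL cm) (lim_chart_at j cL cm) (cE i j ij)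
  (GammaE (cm i)) (GammaE (cm j))).
exact: hD.2.
Qed.

(** The functionals of a compatible family of jets are compatible by the expression
    of the pullback in charts. Conversely, given compatible functionals, the jets
    with these first components are compatible because [G] is. *)
Lemma lim_dissection_reps (m : lim_space M) (G : hom2 S) : lim_dom c m ->
  (forall i, G i = Gamma_ (c i (m i))) ->
  [set (fun i => jet_rep (c i) (s i)) | s in lim_dissection D (m := m)] =
  lim_dissection_rep G.
Proof.
move=> cm GE; have [_ cE _ _] := cL.
have pb i j (ij : (i <= j)%N) := jet_pullback_rep (ms_map_smooth M ij)
  (lim_fun_map m ij) (lim_chart_at i cL cm) (lim_chart_at j cL cm) (cE i j ij).
apply/seteqP; split=> [_ [s Ds <-]|r [rC rG]].
  split=> [i j ij x|i].
    have <- : jet_pullback (ms_map M j i) (m j) (s i) = s j.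
      by have /asboolP := lim_jet2P s; exact.
    by have [-> _] := pb i j ij (s i).
  by rewrite GE -GammaE//; exists (s i) => //; exact: Ds.
have rs i : exists2 s : jet2 (m i), D s & jet_rep (c i) s = r i.
  by have := rG i; rewrite GE -GammaE.
pose s i := projT1 (cid2 (rs i)).
have Ds i : D (s i) by rewrite /s; case: cid2.
have sr i : jet_rep (c i) (s i) = r i by rewrite /s; case: cid2.
have sP : (s : prod_topology (fun i => jet2 (m i))) \in @lim_jet2_pred R S M m.
  apply/asboolP => i j ij; apply: (jet_rep_inj (lim_chart_at j cL cm)).
  have [e1 e2] := pb i j ij (s i).
  rewrite [LHS]surjective_pairing [RHS]surjective_pairing !sr.
  congr pair; apply/clin_ext => x; first by rewrite e1 sr (rC i j ij).
  apply/clin_ext => y; rewrite e2 sr (rG i) (rG j) (rC i j ij).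
  have -> // : G i (bs_map S j i x) (bs_map S j i y) = bs_map S j i (G j x y).
  by have /asboolP := hom2P G; exact.
by exists (LimJet2 sP) => //; apply/functional_extensionality_dep => i; exact: sr.
Qed.

End Chart.

End LimitDissection.

Theorem theorem5p3 (R : realType) (S : banachSystem R) (M : manifoldSystem S)
    (D : forall i (m : M i), set (jet2 m)) (hD : is_dissection_system D) :
  is_lim_dissection (lim_dissection D).
Proof.
split=> [m|c cL].
  by split; [exact: lim_dissection_group|exact: lim_dissection_closed].
have [ac cE _ oimg] := cL.
have Gex i := (hD.1 i).2 (c i) (ac i).
pose Gamma_ i := projT1 (cid (Gex i)).
have GammaP i := projT2 (cid (Gex i)).
have GammaS i : smooth_on (chart_img (c i)) (Gamma_ i) by case: (GammaP i).
have GammaC i u : chart_img (c i) u -> forall x y, Gamma_ i u x y = Gamma_ i u y x.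
  by case: (GammaP i) => _ + _; exact.
have GammaE i m : chart_dom (c i) m ->
    [set jet_rep (c i) s | s in D i m] = dissection_rep (Gamma_ i (c i m)).
  by case: (GammaP i) => _ _; exact.
have Gu (u : frechet S) : exists h : hom2 S, lim_img c u -> forall i, h i = Gamma_ i (u i).
  have [[m cm um]|nu] := pselect (lim_img c u); last by exists 0.
  exists (Hom2 (Gamma_compat hD cL GammaE cm)) => _ i.
  by rewrite um.
have [Gamma GuE] := choice Gu.
exists Gamma_, Gamma; split=> //.
- move=> n; apply: (@frechet_Ck_hom2 R S n (frechet S) _
    (fun i (u : frechet S) => u i) _ (fun i => chart_img (c i)) Gamma_) => //.
  + exact: frechet_line_cvg.
  + exact: frechet_proj_continuous.
  + by move=> i; exact: chart_imgO.
  + by move=> i u [m cm um]; exists (m i); [exact: cm|rewrite um].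
- move=> u cu i; split=> [|x y]; first exact: GuE.
  rewrite GuE//; apply: GammaC.
  by have [m cm um] := cu; exists (m i); [exact: cm|rewrite um].
- move=> m u cm um; apply: (lim_dissection_reps cL GammaE) => // i.
  by rewrite GuE -?um//; exists m.
Qed.
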